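(* Let $n,m\ge 1$ be integers, let $\alpha_1,\dots,\alpha_m>0$ and $\alpha=\alpha_1+\cdots+\alpha_m$. If $$\mathcal{B}^h_m:=\int_{(\mathbb{H}^n)^m}\frac{\prod_{i=1}^m|y_i|_h^{-\alpha_i}}{[\max(1,|y_1|_h^Q,\dots,|y_m|_h^Q)]^m}\,dy_1\cdots dy_m<\infty,$$ then the $m$-linear Hardy–Littlewood–Pólya operator $$P^h_m(f_1,\dots,f_m)(x)=\int_{(\mathbb{H}^n)^m}\frac{f_1(y_1)\cdots f_m(y_m)}{[\max(|x|_h^Q,|y_1|_h^Q,\dots,|y_m|_h^Q)]^m}\,dy_1\cdots dy_m,\qquad x\in\mathbb{H}^n\setminus\{0\},$$ is bounded from $H^\infty_{\alpha_1}(\mathbb{H}^n)\times\cdots\times H^\infty_{\alpha_m}(\mathbb{H}^n)$ to $H^\infty_\alpha(\mathbb{H}^n)$, and $$\|P^h_m\|_{\prod_{i=1}^m H^\infty_{\alpha_i}(\mathbb{H}^n)\to H^\infty_\alpha(\mathbb{H}^n)}=\frac{mQ\,\omega_Q^m}{\alpha\prod_{j=1}^m(Q-\alpha_j)} .$$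
   Context: The Heisenberg group $\mathbb{H}^n$ is $\mathbb{R}^{2n}\times\mathbb{R}$ with group law $x\circ y=\big(x_1+y_1,\dots,x_{2n}+y_{2n},\,x_{2n+1}+y_{2n+1}+2\sum_{j=1}^n(y_jx_{n+j}-x_jy_{n+j})\big)$ and dilations $\delta_r(x_1,\dots,x_{2n},x_{2n+1})=(rx_1,\dots,rx_{2n},r^2x_{2n+1})$, $r>0$. Its Haar measure $dx$ is Lebesgue measure on $\mathbb{R}^{2n+1}$, and $|\delta_r(E)|=r^Q|E|$ with $Q=2n+2$. The norm is $|x|_h=\big[(\sum_{i=1}^{2n}x_i^2)^2+x_{2n+1}^2\big]^{1/4}$. $\Omega_Q=|B(0,1)|$ is the Lebesgue measure of the unit ball $\{y\in\mathbb{H}^n:|y|_h<1\}$ and $\omega_Q=Q\,\Omega_Q$. For $\alpha>0$, $H^\infty_\alpha(\mathbb{H}^n)$ is the space of measurable functions $f$ on $\mathbb{H}^n$ (modulo equality a.e.) with $\|f\|_{H^\infty_\alpha(\mathbb{H}^n)}:=\operatorname{ess\,sup}_{x\in\mathbb{H}^n}|x|_h^\alpha|f(x)|<\infty$. An $m$-linear integral operator $T$ is bounded from $\prod_{i}H^\infty_{\alpha_i}(\mathbb{H}^n)$ to $H^\infty_\alpha(\mathbb{H}^n)$ if for all $f_i\in H^\infty_{\alpha_i}(\mathbb{H}^n)$ the defining integral converges absolutely for a.e. $x$ and $\|T(f_1,\dots,f_m)\|_{H^\infty_\alpha}\le C\prod_i\|f_i\|_{H^\infty_{\alpha_i}}$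 for some constant $C<\infty$ independent of the $f_i$; the operator norm is the least such $C$. *)

(* Defs.v *)
(* MathComp-Analysis, over an arbitrary [R : realType]. *)
From HB Require Import structures.
From mathcomp Require Import all_boot all_order all_algebra.
From mathcomp Require Import all_classical all_reals all_analysis.
From mathcomp Require Import ess_sup_inf.
From mathcomp Require Import ring.

Set Implicit Arguments.
Unset Strict Implicit.
Unset Printing Implicit Defensive.

Import Order.TTheory GRing.Theory Num.Theory.
Import numFieldNormedType.Exports.

Local Open Scope classical_set_scope.
Local Open Scope ring_scope.

Section cons_measure.
Local Open Scope ereal_scope.
Context d (T : measurableType d) (R : realType) (n : nat).
Variables (m1 : {sigma_finite_measure set T -> \bar R}).
Variables (m2 : {sigma_finite_measure set (n.-tuple T) -> \bar R}).

Definition consT (xy : T * n.-tuple T) : n.+1.-tuple T := [tuple of xy.1 :: xy.2].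

(* The product of m1 and m2, transported to n.+1.-tuple T. *)
Definition cons_measure (A : set (n.+1.-tuple T)) : \bar R :=
  pushforward (m1 \x m2) consT A.

Let measurable_consT : measurable_fun [set: T * n.-tuple T] consT.
Proof. exact: measurable_cons. Qed.

Let measurable_consT_preimage A : measurable A -> measurable (consT @^-1` A).
Proof. by move=> mA; rewrite -[X in measurable X]setTI; exact: measurable_consT. Qed.

Let cons_measure0 : cons_measure set0 = 0.
Proof. by rewrite /cons_measure /pushforward preimage_set0 measure0. Qed.

Let cons_measure_ge0 A : 0 <= cons_measure A.
Proof. exact: measure_ge0. Qed.

Let cons_measure_sigma_additive : semi_sigma_additive cons_measure.
Proof.
move=> F mF tF mUF; rewrite /cons_measure /pushforward preimage_bigcup.
apply: measure_semi_sigma_additive.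
- by move=> k; exact: measurable_consT_preimage.
- apply/trivIsetP => /= i j _ _ ij; rewrite -preimage_setI.
  by move/trivIsetP : tF => /(_ _ _ _ _ ij) ->//; rewrite preimage_set0.
- by rewrite -preimage_bigcup; exact: measurable_consT_preimage.
Qed.

HB.instance Definition _ := isMeasure.Build _ _ _ cons_measure
  cons_measure0 cons_measure_ge0 cons_measure_sigma_additive.

Lemma cons_measureE (A : set T) (B : set (n.-tuple T)) :
  measurable A -> measurable B ->
  cons_measure [set t | A (thead t) /\ B [tuple of behead t]] = m1 A * m2 B.
Proof.
move=> mA mB; rewrite /cons_measure /pushforward -product_measure1E//.
congr (_ _); apply/seteqP; split=> -[x y] /=; rewrite theadE.
  by move=> [Ax By]; split=> //; congr B : By; exact/val_inj.
by move=> [Ax By]; split=> //; congr B : By; exact/val_inj.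
Qed.

Let measurable_cons_box (A : set T) (B : set (n.-tuple T)) :
  measurable A -> measurable B ->
  measurable [set t : n.+1.-tuple T | A (thead t) /\ B [tuple of behead t]].
Proof.
move=> mA mB.
have mh : measurable ((fun t : n.+1.-tuple T => thead t) @^-1` A).
  by rewrite -[X in measurable X]setTI; exact: (measurable_tnth ord0).
have mt : measurable
    ((fun t : n.+1.-tuple T => [tuple of behead t] : n.-tuple T) @^-1` B).
  by rewrite -[X in measurable X]setTI; exact: measurable_behead.
exact: measurableI mh mt.
Qed.

Let cons_measure_sigma_finite : sigma_finite setT cons_measure.
Proof.
have /sigma_finiteP[F [TF ndF Foo]] := sigma_finiteT m1.
have /sigma_finiteP[G [TG ndG Goo]] := sigma_finiteT m2.
exists (fun k => [set t | F k (thead t) /\ G k [tuple of behead t]]).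
  rewrite predeqE => t; split=> // _.
  have : setT (thead t) by [].
  rewrite TF => -[i _ Fi].
  have : setT ([tuple of behead t] : n.-tuple T) by [].
  rewrite TG => -[j _ Gj].
  exists (maxn i j) => //; split.
  - by move: Fi; exact/subsetPset/ndF/leq_maxl.
  - by move: Gj; exact/subsetPset/ndG/leq_maxr.
move=> k; have [? ?] := Foo k; have [? ?] := Goo k.
split; first exact: measurable_cons_box.
by rewrite cons_measureE// lte_mul_pinfty// ge0_fin_numE.
Qed.

HB.instance Definition _ := Measure_isSigmaFinite.Build _ _ _ cons_measure
  cons_measure_sigma_finite.

End cons_measure.

(* The k-fold product mu \x ... \x mu on k.-tuple T, for a sigma-finite mu
   (a unit mass on the only point when k = 0). *)
Fixpoint power_measure d (T : measurableType d) (R : realType)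
    (mu : {sigma_finite_measure set T -> \bar R}) (k : nat) :
    {sigma_finite_measure set (k.-tuple T) -> \bar R} :=
  match k with
  | 0 => \d_([tuple] : 0.-tuple T)
  | k'.+1 => cons_measure mu (power_measure mu k')
  end.

Lemma power_measureE d (T : measurableType d) (R : realType)
    (mu : {sigma_finite_measure set T -> \bar R}) (k : nat) (A : 'I_k -> set T) :
  (forall i, measurable (A i)) ->
  power_measure mu k [set t | forall i, A i (tnth t i)]
    = (\prod_(i < k) mu (A i))%E.
Proof.
elim: k A => [|k IHk] A mA /=.
  rewrite big_ord0 diracE mem_set//=; by case.
rewrite big_ord_recl -IHk//.
have mB : measurable [set t : k.-tuple T | forall i, A (lift ord0 i) (tnth t i)].
  have -> : [set t : k.-tuple T | forall i, A (lift ord0 i) (tnth t i)] =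
      \bigcap_(i : 'I_k) ((fun t => tnth t i) @^-1` A (lift ord0 i)).
    by apply/seteqP; split=> t /= tA i => [_|]; exact: tA.
  apply: fin_bigcap_measurable => // i _.
  by rewrite -[X in measurable X]setTI; exact: measurable_tnth.
have tnth_tl (t : k.+1.-tuple T) i :
    tnth ([tuple of behead t] : k.-tuple T) i = tnth t (lift ord0 i).
  by rewrite [in RHS](tuple_eta t) tnthS.
rewrite -cons_measureE//; congr (cons_measure _ _ _).
apply/seteqP; split=> t /=.
  by move=> tA; split=> [|i]; [exact: tA|rewrite tnth_tl; exact: tA].
move=> [A0 AS] i; case: (unliftP ord0 i) => [j|] ->//.
by rewrite -tnth_tl; exact: AS.
Qed.

Lemma sigma_finite_product_measure1 d1 d2 (T1 : measurableType d1)
    (T2 : measurableType d2) (R : realType)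
    (m1 : {sigma_finite_measure set T1 -> \bar R})
    (m2 : {sigma_finite_measure set T2 -> \bar R}) :
  sigma_finite setT (m1 \x m2)%E.
Proof.
have /sigma_finiteP[F [TF ndF Foo]] := sigma_finiteT m1.
have /sigma_finiteP[G [TG ndG Goo]] := sigma_finiteT m2.
exists (fun k => F k `*` G k).
  rewrite -setXTT TF TG predeqE => -[x y]; split.
    move=> [/= [i _ Fi] [j _ Gj]]; exists (maxn i j) => //; split.
    - by move: x Fi; exact/subsetPset/ndF/leq_maxl.
    - by move: y Gj; exact/subsetPset/ndG/leq_maxr.
  by move=> [k _ []/= ? ?]; split; exists k.
move=> k; have [? ?] := Foo k; have [? ?] := Goo k.
split; first exact: measurableX.
by rewrite product_measure1E// lte_mul_pinfty// ge0_fin_numE.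
Qed.

(* R^(2n) x R. The reals are taken as [measurableTypeR R], the copy of R on
   which [lebesgue_measure] lives. *)
Definition heis (R : realType) (n : nat) : Type :=
  ((n + n).-tuple (measurableTypeR R) * measurableTypeR R)%type.

HB.instance Definition _ R n := Choice.on (heis R n).
HB.instance Definition _ R n := Measurable.on (heis R n).

(* hcoord x i is x_(i+1) for i < 2n, and hlast x is x_(2n+1); so for j < n the
   coordinates x_(j+1) and x_(n+j+1) have indices lshift n j and rshift n j. *)
Definition hcoord (R : realType) (n : nat) (x : heis R n) (i : 'I_(n + n)) : R :=
  tnth x.1 i.

Definition hlast (R : realType) (n : nat) (x : heis R n) : R := x.2.

Section heisenberg_group.
Context (R : realType) (n : nat).
Implicit Types x y : heis R n.

Definition hmk (z : 'I_(n + n) -> R) (t : R) : heis R n :=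
  ([tuple (z i : measurableTypeR R) | i < n + n], t).

Definition heis_mul x y : heis R n :=
  hmk (fun i => hcoord x i + hcoord y i)
    (hlast x + hlast y + 2 * \sum_(j < n)
      (hcoord y (lshift n j) * hcoord x (rshift n j)
       - hcoord x (lshift n j) * hcoord y (rshift n j))).

Definition heis_one : heis R n := hmk (fun=> 0) 0.

Definition heis_inv x : heis R n := hmk (fun i => - hcoord x i) (- hlast x).

Let hmkE z t : (hcoord (hmk z t) =1 z) * (hlast (hmk z t) = t).
Proof. by split=> // i; rewrite /hcoord tnth_mktuple. Qed.

Let heisP x y : hcoord x =1 hcoord y -> hlast x = hlast y -> x = y.
Proof.
by case: x y => [x s] [y t] xy st; congr pair => //; exact: eq_from_tnth.
Qed.

Let heis_mulA : associative heis_mul.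
Proof.
move=> x y z; apply: heisP => [i|]; rewrite !hmkE ?addrA//.
set S1 := \sum_(j < n) _; set S2 := \sum_(j < n) _.
set S3 := \sum_(j < n) _; set S4 := \sum_(j < n) _.
have S1234 : S2 + S1 = S4 + S3.
  by rewrite -!big_split/=; apply: eq_bigr => j _; rewrite !hmkE; ring.
transitivity (hlast x + hlast y + hlast z + 2 * (S2 + S1)); first by ring.
by rewrite S1234; ring.
Qed.

Let heis_mul1 : left_id heis_one heis_mul.
Proof.
move=> x; apply: heisP => [i|]; rewrite !hmkE ?add0r//.
by rewrite big1 ?mulr0 ?addr0// => j _; rewrite !hmkE; ring.
Qed.

Let heis_mulr1 : right_id heis_one heis_mul.
Proof.
move=> x; apply: heisP => [i|]; rewrite !hmkE ?addr0//.
by rewrite big1 ?mulr0 ?addr0// => j _; rewrite !hmkE; ring.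
Qed.

Let heis_mulV : left_inverse heis_one heis_inv heis_mul.
Proof.
move=> x; apply: heisP => [i|]; rewrite !hmkE ?addNr//.
by rewrite big1 ?mulr0 ?addr0// => j _; rewrite !hmkE; ring.
Qed.

Let heis_mulrV : right_inverse heis_one heis_inv heis_mul.
Proof.
move=> x; apply: heisP => [i|]; rewrite !hmkE ?subrr//.
by rewrite big1 ?mulr0 ?addr0// => j _; rewrite !hmkE; ring.
Qed.

HB.instance Definition _ := isGroup.Build (heis R n)
  heis_mulA heis_mul1 heis_mulr1 heis_mulV heis_mulrV.

End heisenberg_group.

Section heisenberg_analysis.
Context (R : realType) (n : nat).
Local Notation H := (heis R n).
Implicit Types (x : H) (f : H -> R).

(* Lebesgue measure on R^(2n+1), on the Borel sigma-algebra. *)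
Definition heis_lebesgue : set H -> \bar R :=
  (power_measure (@lebesgue_measure R) (n + n) \x @lebesgue_measure R)%E.

HB.instance Definition _ := Measure.on heis_lebesgue.

HB.instance Definition _ := Measure_isSigmaFinite.Build _ _ _ heis_lebesgue
  (sigma_finite_product_measure1 _ _).

Definition hdim : nat := (2 * n + 2)%N.

Definition hnorm x : R :=
  ((\sum_(i < n + n) hcoord x i ^+ 2) ^+ 2 + hlast x ^+ 2) `^ (4%:R^-1).

Definition Omega_Q : R := fine (heis_lebesgue [set y | hnorm y < 1]).

Definition omega_Q : R := hdim%:R * Omega_Q.

Definition Hinf_norm (a : R) f : \bar R :=
  ess_sup heis_lebesgue (fun x => (hnorm x `^ a * `|f x|)%:E).

Definition Hinf (a : R) : set (H -> R) :=
  [set f | measurable_fun [set: H] f /\ (Hinf_norm a f < +oo)%E].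

Section multilinear_operator.
Variables (m : nat) (K : H -> m.-tuple H -> R).

Definition mlin_integrand (f : 'I_m -> H -> R) x (y : m.-tuple H) : R :=
  (\prod_(i < m) f i (tnth y i)) * K x y.

Definition mlin_op (f : 'I_m -> H -> R) x : R :=
  \int[power_measure heis_lebesgue m]_y mlin_integrand f x y.

Definition op_bound (a : 'I_m -> R) (b C : R) : Prop :=
  forall f : 'I_m -> H -> R, (forall i, Hinf (a i) (f i)) ->
  [/\ {ae heis_lebesgue, forall x, (power_measure heis_lebesgue m).-integrable
         [set: m.-tuple H] (fun y => (mlin_integrand f x y)%:E)},
      Hinf b (mlin_op f) &
      (Hinf_norm b (mlin_op f) <= C%:E * \prod_(i < m) Hinf_norm (a i) (f i))%E].

Definition op_bounded (a : 'I_m -> R) (b : R) : Prop := exists C, op_bound a b C.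

Definition is_op_norm (a : 'I_m -> R) (b C : R) : Prop :=
  op_bound a b C /\ forall C', op_bound a b C' -> C <= C'.

End multilinear_operator.

Definition hlp_kernel (m : nat) x (y : m.-tuple H) : R :=
  ((\big[Num.max/hnorm x ^+ hdim]_(i < m) hnorm (tnth y i) ^+ hdim) ^+ m)^-1.

(* [0 `^ (- a i) = 0] in the library; this only affects the null set where
   some y_i is 0. *)
Definition hlp_const (m : nat) (a : 'I_m -> R) : \bar R :=
  (\int[power_measure heis_lebesgue m]_y
    ((\prod_(i < m) hnorm (tnth y i) `^ (- a i))
     / (\big[Num.max/1]_(i < m) hnorm (tnth y i) ^+ hdim) ^+ m)%:E)%E.

End heisenberg_analysis.

Arguments heis_lebesgue R n : clear implicits.
Arguments Omega_Q R n : clear implicits.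
Arguments omega_Q R n : clear implicits.
Arguments hlp_kernel R n m : clear implicits.
Arguments hlp_const R n {m} a.

(* Main.v *)
(* Up to null sets the function |y|_h^(-a) has norm 1 in H^oo_a and dominates every
   function of norm at most 1, so the operator norm is attained at
   f_i = |y|_h^(-a_i), and everything reduces to evaluating, for r = |x|_h > 0,
     I(r) = \int \prod_i |y_i|_h^(-a_i) max(r, |y_1|_h, ..., |y_m|_h)^(-Qm) dy
   as a constant times r^(-alpha). No polar coordinates are needed: writing
   u^(-p) = \int_u^oo p s^(-p-1) ds turns I(r) into
     \int_r^oo Qm s^(-Qm-1) \prod_i V_i(s) ds,
     V_i(s) = \int_(|y|_h < s) |y|_h^(-a_i) dy,
   and the same formula together with |B(0,s)| = s^Q Omega_Q gives
   V_i(s) = omega_Q s^(Q-a_i) / (Q-a_i) when a_i < Q. When a_i >= Q, V_i and hence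
   I(1) are infinite, so the assumption I(1) < oo forces a_i < Q for all i. *)
Require Import Defs.
From mathcomp Require Import all_boot all_order all_algebra.
From mathcomp Require Import all_classical all_reals all_analysis.
From mathcomp Require Import measurable_realfun ess_sup_inf.
From mathcomp Require Import ring lra.

Set Implicit Arguments.
Unset Strict Implicit.
Unset Printing Implicit Defensive.

Import Order.TTheory GRing.Theory Num.Theory.
Import numFieldNormedType.Exports.

Local Open Scope classical_set_scope.
Local Open Scope ring_scope.

(** * Integration against a power measure *)

Section power_measure_integral.
Local Open Scope ereal_scope.
Context d (T : measurableType d) (R : realType).

Lemma ge0_integral_cons_measure n (m1 : {sigma_finite_measure set T -> \bar R})
    (m2 : {sigma_finite_measure set (n.-tuple T) -> \bar R})
    (f : n.+1.-tuple T -> \bar R) :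
  measurable_fun [set: n.+1.-tuple T] f -> (forall t, 0 <= f t) ->
  \int[cons_measure m1 m2]_t f t =
  \int[m1]_x \int[m2]_t f [tuple of x :: t].
Proof.
move=> mf f0.
have mc : measurable_fun [set: T * n.-tuple T] (@consT d T n).
  exact: measurable_cons.
transitivity (\int[pushforward (m1 \x m2) (@consT d T n)]_t f t).
  by apply: eq_measure_integral.
rewrite ge0_integral_pushforward// preimage_setT fubini_tonelli1//.
  exact: measurableT_comp.
by move=> x; exact: f0.
Qed.

Variable mu : {sigma_finite_measure set T -> \bar R}.

Lemma measurable_prod_tnth n (g : 'I_n -> T -> R) :
  (forall i, measurable_fun [set: T] (g i)) ->
  measurable_fun [set: n.-tuple T] (fun t => \prod_(i < n) g i (tnth t i))%R.
Proof.
move=> mg; apply: measurable_prod => i _.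
exact: (measurableT_comp (mg i) (measurable_tnth i)).
Qed.

Lemma integral_power_measure_prod n (g : 'I_n -> T -> R) :
  (forall i, measurable_fun [set: T] (g i)) -> (forall i x, 0 <= g i x)%R ->
  \int[power_measure mu n]_t (\prod_(i < n) g i (tnth t i))%:E =
  \prod_(i < n) \int[mu]_x (g i x)%:E.
Proof.
elim: n g => [|n IHn] g mg g0.
  rewrite big_ord0 /= integral_dirac//=.
    by rewrite diracT mul1e big_ord0.
  by apply/measurable_EFinP; exact: measurable_prod_tnth.
rewrite big_ord_recl /= ge0_integral_cons_measure/=; last 2 first.
- by apply/measurable_EFinP; exact: measurable_prod_tnth.
- by move=> t; rewrite lee_fin prodr_ge0.
under eq_integral => x _.
  under eq_integral => t _.
    rewrite big_ord_recl tnth0 EFinM.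
    under eq_bigr do rewrite tnthS.
    over.
  rewrite ge0_integralZl_EFin//; last 2 first.
  - by move=> t _; rewrite lee_fin prodr_ge0.
  - by apply/measurable_EFinP; exact: (measurable_prod_tnth (fun i => mg _)).
  rewrite (IHn (fun i => g (lift ord0 i)))//.
  over.
rewrite ge0_integralZr//.
- by apply/measurable_EFinP.
- by move=> x _; rewrite lee_fin.
- by apply: prode_ge0 => i _; apply: integral_ge0 => x _; rewrite lee_fin.
Qed.

(** The cylinder over a null set lies in a box with one null factor. Its measure is a product
    containing 0, which is 0 even if the other factors are infinite. This carries almost-everywhere
    bounds on each [f i] over to the product space. *)
Lemma negligible_tnth n (i : 'I_n) (N : set T) :
  mu.-negligible N ->
  (power_measure mu n).-negligible [set t | N (tnth t i)].
Proof.
move=> [A [mA A0 NA]]; pose B j := if j == i then A else setT.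
have mB j : measurable (B j) by rewrite /B; case: ifPn.
exists [set t : n.-tuple T | forall j, B j (tnth t j)]; split.
- have -> : [set t : n.-tuple T | forall j, B j (tnth t j)] =
      \bigcap_(j : 'I_n) ((fun t => tnth t j) @^-1` B j).
    by apply/seteqP; split=> t /= tA j => [_|]; exact: tA.
  apply: fin_bigcap_measurable => // j _.
  by rewrite -[X in measurable X]setTI; exact: measurable_tnth.
- rewrite power_measureE// (bigD1 i)//=.
  by rewrite (_ : B i = A) ?A0 ?mul0e// /B eqxx.
- by move=> t /= Nt j; rewrite /B; case: eqP => // ->; exact: NA.
Qed.

Lemma ae_forall_tnth n (P : 'I_n -> T -> Prop) :
  (forall i, {ae mu, forall x, P i x}) ->
  {ae power_measure mu n, forall t, forall i, P i (tnth t i)}.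
Proof.
move=> aeP.
(* Countable intersection is available over [nat], so the finite index is replaced by a natural
   number, with an empty condition from [n] on. *)
have /ae_foralln : forall k : nat, {ae power_measure mu n,
    forall t, forall i : 'I_n, i = k :> nat -> P i (tnth t i)}.
  move=> k; have [kn|nk] := ltnP k n; last first.
    by apply: aeW => t i ik; move: nk; rewrite -ik leqNgt ltn_ord.
  apply: negligibleS (negligible_tnth (Ordinal kn) (aeP (Ordinal kn))).
  move=> t /= Pt Pk; apply: Pt => i ik.
  by rewrite (_ : i = Ordinal kn)//; exact: val_inj.
by apply: filterS => t Pt i; exact: Pt.
Qed.

End power_measure_integral.

(** * Integrals of powers and the layer-cake formula *)

Section powR_integrals.
Context (R : realType).
Implicit Types p q s t : R.
Local Notation leb := (@lebesgue_measure R).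

Lemma continuous_powR p (x : R) : 0 < x -> {for x, continuous (@powR R ^~ p)}.
Proof.
move=> x0; apply: differentiable_continuous; apply/derivable1_diffP.
by apply: derivable_powR; rewrite in_itv/= andbT.
Qed.

(** The antiderivative [- s ^ (-p)] tends to 0 at infinity because [p > 0]. *)
Lemma integral_powR_tail p t : 0 < p -> 0 < t ->
  (\int[leb]_(s in `]t, +oo[) (p * s `^ (- p - 1))%:E = (t `^ (- p))%:E)%E.
Proof.
move=> p0 t0.
have dF (x : R) : 0 < x ->
    is_derive x (1 : R) (fun s => - s `^ (- p)) (p * x `^ (- p - 1)).
  move=> x0; have -> : p * x `^ (- p - 1) = - (- p * x `^ (- p - 1)) by ring.
  by apply: is_deriveN; exact: is_derive1_powR.
rewrite integral_itv_obnd_cbnd; last first.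
  apply/measurable_EFinP; apply: measurable_funTS.
  by apply: measurable_funM => //; exact: measurable_powR.
rewrite (@ge0_continuous_FTC2y _ _ (fun s => - s `^ (- p)) t 0).
- by rewrite sub0e -EFinN opprK.
- by move=> x _; rewrite mulr_ge0 ?powR_ge0 ?ltW.
- apply: continuous_in_subspaceT => x; rewrite inE/= in_itv/= andbT => tx.
  apply: cvgM; first exact: cvg_cst.
  by apply: continuous_powR; exact: lt_le_trans tx.
- rewrite -oppr0; apply: cvgN.
  under eq_fun do rewrite powRN.
  apply/gtr0_cvgV0; first by near=> s; rewrite powR_gt0.
  apply/cvgryPge => M; near=> s.
  have M0 : 0 <= `|M| by [].
  (* Writing [|M|] as [(|M| ^ (1/p)) ^ p] shows that [s ^ p] exceeds [M] as soon as [s] is at least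
     [|M| ^ (1/p)]. *)
  rewrite (le_trans (ler_norm M))// -[leLHS]powRr1//.
  rewrite -(mulVf (lt0r_neq0 p0)) powRrM ge0_ler_powR ?ltW// ?nnegrE ?powR_ge0//.
- by move=> x tx; have [] := dF x (lt_trans t0 tx).
- by apply: cvgN; apply: cvg_at_right_filter; exact: continuous_powR.
- move=> x; rewrite in_itv/= andbT => tx.
  by rewrite derive1E; have [_ ->] := dF x (lt_trans t0 tx).
Unshelve. all: by end_near. Qed.

(** For [q < 1] the integrand is unbounded at 0, so the fundamental theorem is applied on intervals
    [[u k, t]] with [u k] decreasing to 0. Monotone convergence gives the integral as the limit of
    [t ^ q - u k ^ q]. *)
Lemma integral_powR_head q t : 0 < q -> 0 < t ->
  (\int[leb]_(s in `]0%R, t]) (q * s `^ (q - 1))%:E = (t `^ q)%:E)%E.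
Proof.
move=> q0 t0.
have dF (x : R) : 0 < x ->
    is_derive x (1 : R) (fun s => s `^ q) (q * x `^ (q - 1)).
  by move=> x0; exact: is_derive1_powR.
(* The shift by 2 keeps [u k < t] already at [k = 0]. *)
pose u (k : nat) : R := t / k.+2%:R.
have u0 k : 0 < u k by rewrite divr_gt0.
have ut k : u k < t by rewrite /u ltr_pdivrMr// ltr_pMr// ltr1n.
have FE k : (\int[leb]_(s in `[u k, t]) (q * s `^ (q - 1))%:E =
    (t `^ q - u k `^ q)%:E)%E.
  rewrite (@continuous_FTC2 _ _ (fun s => s `^ q)) ?EFinB//.
  - apply: continuous_in_subspaceT => z; rewrite inE/= in_itv/= => /andP[uz _].
    apply: cvgM; first exact: cvg_cst.
    by apply: continuous_powR; exact: lt_le_trans uz.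
  - split.
    + move=> x; rewrite in_itv/= => /andP[ux _].
      by have [] := dF x (lt_trans (u0 k) ux).
    + by apply: cvg_at_right_filter; exact: continuous_powR.
    + by apply: cvg_at_left_filter; exact: continuous_powR.
  - move=> x; rewrite in_itv/= => /andP[ux _].
    by rewrite derive1E; have [_ ->] := dF x (lt_trans (u0 k) ux).
have UE : `]0, t]%classic = \bigcup_k `[u k, t]%classic.
  apply/seteqP; split => [y /=|y].
    rewrite in_itv/= => /andP[y0 yt]; exists (Num.bound (t / y)) => //=.
    rewrite in_itv/= yt andbT /u ler_pdivrMr// mulrC -ler_pdivrMr//.
    have /ltW/le_trans := archi_boundP (ltW (divr_gt0 t0 y0)); apply.
    by rewrite ler_nat -addn2 leq_addr.
  move=> [k _ /=]; rewrite !in_itv/= => /andP[uy ->].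
  by rewrite (lt_le_trans (u0 k)).
have cvgU : (t `^ q - u k `^ q)%:E
    @[k --> \oo] --> (\int[leb]_(s in `]0%R, t]) (q * s `^ (q - 1))%:E)%E.
  under eq_fun do rewrite -FE.
  rewrite UE; apply: ge0_nondecreasing_set_cvg_integral => //.
  - move=> i j ij; apply/subsetPset; apply: subset_itvr; rewrite bnd_simp.
    by rewrite /u ler_pM2l// lef_pV2 ?posrE ?ltr0n// ler_nat.
  - move=> k; apply/measurable_EFinP; apply: measurable_funTS.
    by apply: measurable_funM => //; exact: measurable_powR.
  - by move=> k x _; rewrite lee_fin mulr_ge0 ?powR_ge0 ?ltW.
apply: cvg_unique cvgU _ => //.
apply: cvg_EFin; first exact: nearW.
rewrite -[X in _ --> X]subr0; apply: cvgB; first exact: cvg_cst.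
have /cvg_at_rightP := powR_cvg0 q0; apply; split=> //.
rewrite -(mulr0 t); apply: cvgM; first exact: cvg_cst.
by rewrite (@cvg_shiftS _ (@harmonic R)); exact: cvg_harmonic.
Qed.

End powR_integrals.

Section layer_cake.
Local Open Scope ereal_scope.
Context d (T : measurableType d) (R : realType).
Variable mu : {sigma_finite_measure set T -> \bar R}.
Local Notation leb := (@lebesgue_measure R).

Lemma integral_mulr_gt (f : R -> R) (r : R) :
  \int[leb]_s (f s * (r < s)%R%:R)%:E = \int[leb]_(s in `]r, +oo[) (f s)%:E.
Proof.
rewrite [RHS]integral_mkcond; apply: eq_integral => s _.
rewrite patchE mem_setE in_itv/= andbT.
by case: ltP => _; rewrite ?mulr1 ?mulr0.
Qed.

Lemma measurable_lt_indicator d' (U : measurableType d') (f g : U -> R) :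
  measurable_fun [set: U] f -> measurable_fun [set: U] g ->
  measurable_fun [set: U] (fun x => (f x < g x)%R%:R : R).
Proof.
move=> mf mg.
exact: (measurableT_comp (f := fun b : bool => b%:R : R) _
  (measurable_fun_ltr mf mg)).
Qed.

(* Tonelli's theorem applied to u^(-p) = \int_u^oo p s^(-p-1) ds. As 0 `^ (- p) = 0
   in the library, the formula fails where N vanishes and w does not. *)
Lemma layer_cake (w N : T -> R) (p : R) : (0 < p)%R ->
  measurable_fun [set: T] w -> measurable_fun [set: T] N ->
  (forall y, 0 <= w y)%R -> (forall y, 0 <= N y)%R ->
  (forall y, N y = 0 -> w y = 0)%R ->
  \int[mu]_y (w y * N y `^ (- p))%:E =
  \int[leb]_s ((p * s `^ (- p - 1))%:E *
               \int[mu]_y (w y * (N y < s)%R%:R)%:E).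
Proof.
move=> p0 mw mN w0 N0 Nw.
have mI s : measurable_fun [set: T] (fun y => w y * (N y < s)%R%:R)%R.
  by apply: measurable_funM => //; exact: measurable_lt_indicator.
pose F (z : measurableTypeR R * T) :=
  ((p * z.1 `^ (- p - 1)) * (w z.2 * (N z.2 < z.1)%R%:R))%:E.
have mF : measurable_fun [set: measurableTypeR R * T] F.
  apply/measurable_EFinP; apply: measurable_funM.
    apply: measurable_funM => //.
    exact: (measurableT_comp (measurable_powR _) measurable_fst).
  apply: measurable_funM.
    exact: (measurableT_comp mw measurable_snd).
  apply: measurable_lt_indicator; last exact: measurable_fst.
  exact: (measurableT_comp mN measurable_snd).
have F0 z : 0 <= F z.
  by rewrite lee_fin; do 2?apply: mulr_ge0 => //; rewrite ?powR_ge0 ?ltW.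
transitivity (\int[leb]_s \int[mu]_y F (s, y)); last first.
  apply: eq_integral => s _; rewrite -ge0_integralZl_EFin//.
  - by move=> y _; rewrite lee_fin mulr_ge0.
  - exact/measurable_EFinP.
  - by rewrite mulr_ge0 ?powR_ge0 ?ltW.
rewrite fubini_tonelli//; apply: eq_integral => y _; rewrite /F/=.
(* After the exchange of integrals [y] is fixed. If [N y = 0], both sides vanish with [w y];
   otherwise the integral over [s > N y] is the tail integral. *)
have [Ny0|Ny0] := eqVneq (N y) 0%R.
  rewrite Nw// mul0r; under eq_integral do rewrite mul0r mulr0.
  by rewrite integral0.
under eq_integral do rewrite mulrCA mulrA.
rewrite integral_mulr_gt.
under eq_integral do rewrite EFinM.
have Nyp : (0 < N y)%R by rewrite lt_neqAle eq_sym Ny0 N0.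
rewrite ge0_integralZl_EFin//; last 2 first.
- by move=> s _; rewrite lee_fin mulr_ge0 ?powR_ge0 ?ltW.
- apply/measurable_EFinP; apply: measurable_funTS.
  by apply: measurable_funM => //; exact: measurable_powR.
by rewrite integral_powR_tail.
Qed.

End layer_cake.

(** * Dilations and balls of the Heisenberg group *)

Section lebesgue_scaling.
Local Open Scope ereal_scope.
Context (R : realType).
Local Notation leb := (@lebesgue_measure R).
Local Notation mR := (measurableTypeR R).

(** [r] times the pushforward of Lebesgue measure under multiplication by [r] agrees with Lebesgue
    measure on half-open intervals, hence on all Borel sets by uniqueness. *)
Lemma lebesgue_measure_scale (r : R) (A : set mR) : (0 < r)%R ->
  measurable A ->
  leb ((fun x : mR => r * x : mR)%R @^-1` A) = r^-1%:E * leb A.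
Proof.
move=> r0 mA.
have mr : measurable_fun [set: mR] (fun x : mR => r * x : mR)%R.
  exact: measurable_funM.
pose rp : {nonneg R} := NngNum (ltW r0).
have := @lebesgue_measure_unique R
  (mscale rp (pushforward leb (fun x : mR => r * x : mR)%R)).
move=> /(_ mr _ _ mA) ->; last first.
  move=> _ [[a b] _ <-]; rewrite /mscale/= /pushforward.
  transitivity (r%:E * leb `](a / r)%R, (b / r)%R]%classic); last first.
    congr (_ * leb _).
    apply/seteqP; split=> x /=; rewrite !in_itv/= ltr_pdivrMr// ler_pdivlMr//;
      by rewrite [(x * r)%R]mulrC.
  rewrite !lebesgue_measure_itv/= !lte_fin ltr_pM2r ?invr_gt0//.
  case: ifPn => _; last by rewrite mule0.
  by rewrite -!EFinB -EFinM; congr EFin; field; exact: lt0r_neq0.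
rewrite /mscale/= /pushforward muleA -EFinM mulVf ?mul1e//.
exact: lt0r_neq0.
Qed.

Lemma ge0_integral_lebesgue_scale (r : R) (f : mR -> \bar R) : (0 < r)%R ->
  measurable_fun [set: mR] f -> (forall x, 0 <= f x) ->
  \int[leb]_x f (r * x)%R = r^-1%:E * \int[leb]_x f x.
Proof.
move=> r0 mf f0.
have mr : measurable_fun [set: mR] (fun x : mR => r * x : mR)%R.
  exact: measurable_funM.
have ri0 : (0 <= r^-1)%R by rewrite invr_ge0 ltW.
rewrite -(@ge0_integral_mscale _ _ _ leb _ measurableT (NngNum ri0))//.
transitivity (\int[pushforward leb (fun x : mR => r * x : mR)%R]_x f x).
  by rewrite ge0_integral_pushforward.
apply: eq_measure_integral => A mA _.
by rewrite /mscale/= /pushforward lebesgue_measure_scale.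
Qed.

Definition tuple_scale (r : R) n (t : n.-tuple mR) : n.-tuple mR :=
  [tuple (r * tnth t i)%R : mR | i < n].

Lemma measurable_tuple_scale r n :
  measurable_fun [set: n.-tuple mR] (@tuple_scale r n).
Proof.
apply/measurable_fun_tnthP => i.
rewrite (_ : _ \o _ = fun t : n.-tuple mR => (r * tnth t i)%R); last first.
  by apply/funext => t /=; rewrite tnth_mktuple.
by apply: measurable_funM => //; exact: measurable_tnth.
Qed.

Lemma tuple_scale_cons r n (x : mR) (t : n.-tuple mR) :
  tuple_scale r [tuple of x :: t] = [tuple of (r * x)%R :: tuple_scale r t].
Proof.
apply: eq_from_tnth => i; rewrite tnth_mktuple.
by case: (unliftP ord0 i) => [j|] ->; rewrite ?tnthS ?tnth0 ?tnth_mktuple.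
Qed.

(** Induction with Tonelli: each coordinate contributes one factor [r^-1]. *)
Lemma ge0_integral_power_lebesgue_scale (r : R) n (f : n.-tuple mR -> \bar R) :
  (0 < r)%R -> measurable_fun [set: n.-tuple mR] f -> (forall t, 0 <= f t) ->
  \int[power_measure leb n]_t f (tuple_scale r t) =
  (r ^- n)%:E * \int[power_measure leb n]_t f t.
Proof.
move=> r0; elim: n f => [|n IHn] f mf f0.
  rewrite expr0 invr1 mul1e; apply: eq_integral => t _; congr f.
  by apply: eq_from_tnth; case.
have mfx (x : mR) : measurable_fun [set: n.-tuple mR] (fun t => f [tuple of x :: t]).
  by apply: (measurableT_comp mf); exact: measurable_cons.
rewrite /= !ge0_integral_cons_measure//; last first.
  by apply: (measurableT_comp mf); exact: measurable_tuple_scale.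
pose g (x : mR) := \int[power_measure leb n]_t f [tuple of x :: t].
have mg : measurable_fun [set: mR] g.
  apply: (@measurable_fun_fubini_tonelli_F _ _ _ _ _ _ (f \o @consT _ mR n)) => //.
    by apply: measurableT_comp => //; exact: measurable_cons.
  by move=> z /=.
have g0 x : 0 <= g x by exact: integral_ge0.
transitivity (\int[leb]_x ((r ^- n)%:E * g (r * x)%R)).
  apply: eq_integral => x _.
  under eq_integral do rewrite tuple_scale_cons.
  exact: (IHn (fun t => f [tuple of (r * x)%R :: t])).
have mgr : measurable_fun [set: mR] (fun x : mR => g (r * x)%R).
  by apply: (measurableT_comp (f := g) mg); exact: measurable_funM.
have rn0 : (0 <= r ^- n)%R by rewrite invr_ge0 exprn_ge0// ltW.
etransitivity.
  apply: ge0_integralZl_EFin;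
    [exact: measurableT|by move=> x _; exact: g0|exact: mgr|exact: rn0].
rewrite (ge0_integral_lebesgue_scale (f := g))// muleA -EFinM -invfM.
by rewrite -exprSr.
Qed.

End lebesgue_scaling.

(** * The homogeneous norm, its dilations and the measure of its balls *)

Section heisenberg_balls.
Context (R : realType) (n : nat).
Local Notation H := (heis R n).
Local Notation leb := (@lebesgue_measure R).
Local Notation mR := (measurableTypeR R).
Local Notation mu := (heis_lebesgue R n).

(** The fourth power of the norm. Being a polynomial, it allows the comparison of the unit ball with
    boxes to avoid real powers. *)
Definition hgauge (x : H) : R :=
  (\sum_(i < n + n) hcoord x i ^+ 2) ^+ 2 + hlast x ^+ 2.

Lemma hgauge_ge0 (x : H) : 0 <= hgauge x.
Proof. by rewrite addr_ge0// sqr_ge0. Qed.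

Lemma hnorm_ge0 (x : H) : 0 <= hnorm x.
Proof. exact: powR_ge0. Qed.

Lemma hnorm_lt1 (x : H) : (hnorm x < 1) = (hgauge x < 1).
Proof.
have := hgauge_ge0 x; rewrite /hnorm -/(hgauge x) => g0.
have e1 : 1 = 1 `^ 4%:R^-1 :> R by rewrite powR1.
apply/idP/idP => [|g1]; last first.
  by rewrite [ltRHS]e1 gt0_ltr_powR// nnegrE.
rewrite !ltNge; apply: contra => g1.
by rewrite [leLHS]e1 ge0_ler_powR// nnegrE.
Qed.

Lemma measurable_hcoord i : measurable_fun [set: H] (fun x => hcoord x i : R).
Proof.
exact: (measurableT_comp (measurable_tnth i) measurable_fst).
Qed.

Lemma measurable_hlast : measurable_fun [set: H] (fun x => hlast x : R).
Proof. exact: measurable_snd. Qed.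

Lemma measurable_hnorm : measurable_fun [set: H] (@hnorm R n).
Proof.
apply: (measurableT_comp (measurable_powR _)).
apply: measurable_funD; apply: measurable_funX; last exact: measurable_hlast.
by apply: measurable_sum => i; apply: measurable_funX; exact: measurable_hcoord.
Qed.

Definition hdil (r : R) (x : H) : H :=
  (tuple_scale r x.1, (r ^+ 2 * x.2 : mR)).

Lemma hgauge_dil r (x : H) : hgauge (hdil r x) = r ^+ 4 * hgauge x.
Proof.
rewrite /hgauge mulrDr; congr (_ + _); last by rewrite /hlast/=; ring.
rewrite (eq_bigr (fun i => r ^+ 2 * hcoord x i ^+ 2)).
  by rewrite -mulr_sumr; ring.
by move=> i _; rewrite /hcoord tnth_mktuple; ring.
Qed.

Lemma hnorm_dil r (x : H) : 0 <= r -> hnorm (hdil r x) = r * hnorm x.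
Proof.
move=> r0; rewrite /hnorm -!/(hgauge _) hgauge_dil powRM ?exprn_ge0 ?hgauge_ge0//.
by rewrite -powR_mulrn// -powRrM mulfV// powRr1.
Qed.

(** The homogeneous dimension appears here: the [2n] horizontal coordinates give [r^-(2n)] and the
    vertical one, scaled by [r^2], gives [r^-2]. *)
Lemma ge0_integral_hdil (r : R) (f : H -> \bar R) : 0 < r ->
  measurable_fun [set: H] f -> (forall x, 0 <= f x)%E ->
  (\int[mu]_x f (hdil r x) = (r ^- hdim n)%:E * \int[mu]_x f x)%E.
Proof.
move=> r0 mf f0.
have mdil : measurable_fun [set: H] (hdil r).
  apply/measurable_fun_pairP; split.
    exact: (measurableT_comp (@measurable_tuple_scale R r (n + n)) measurable_fst).
  by apply: measurable_funM => //; exact: measurable_snd.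
pose g (t : (n + n).-tuple mR) := (\int[leb]_s f (t, s))%E.
have mft t : measurable_fun [set: mR] (fun s => f (t, s)).
  exact: (measurableT_comp mf (measurable_pair1 t)).
have mg : measurable_fun setT g by exact: measurable_fun_fubini_tonelli_F.
have g0 t : (0 <= g t)%E by exact: integral_ge0.
have r20 : 0 <= r ^- 2 by rewrite invr_ge0 exprn_ge0// ltW.
rewrite /heis_lebesgue fubini_tonelli1//; last exact: measurableT_comp.
transitivity (\int[power_measure leb (n + n)]_t
    ((r ^- 2)%:E * g (tuple_scale r t)))%E.
  apply: eq_integral => t _.
  rewrite -(ge0_integral_lebesgue_scale (f := fun s => f (tuple_scale r t, s)))//.
  by rewrite exprn_gt0.
have mgr :
    measurable_fun [set: (n + n).-tuple mR] (fun t => g (tuple_scale r t)).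
  by apply: (measurableT_comp mg); exact: measurable_tuple_scale.
etransitivity.
  apply: ge0_integralZl_EFin;
    [exact: measurableT|by move=> t _; exact: g0|exact: mgr|exact: r20].
rewrite (ge0_integral_power_lebesgue_scale r0 mg g0) muleA -EFinM -invfM.
rewrite -exprD fubini_tonelli1//; congr ((r ^- _)%:E * _)%E.
by rewrite /hdim mul2n addnn addnC.
Qed.

Lemma measurable_hball r : measurable [set x : H | hnorm x < r].
Proof.
have -> : [set x : H | hnorm x < r] = setT `&` (@hnorm R n) @^-1` `]-oo, r[.
  by rewrite setTI; apply/seteqP; split=> x /=; rewrite in_itv.
by apply: measurable_hnorm => //; exact: measurable_itv.
Qed.

(** Boxes have explicit measure. The unit ball lies in the box with [c = 1] and contains one with
    small [c], so its measure is finite and positive. *)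
Definition hbox (c : R) : set H :=
  [set x | (forall i, hcoord x i \in `[- c, c]) /\ hlast x \in `[- c, c]].

Lemma measurable_hbox_base (c : R) : measurable
  [set t : (n + n).-tuple mR | forall i, `[- c, c]%classic (tnth t i)].
Proof.
have -> : [set t : (n + n).-tuple mR | forall i, `[- c, c]%classic (tnth t i)] =
    \bigcap_(i : 'I_(n + n)) ((fun t => tnth t i) @^-1` `[- c, c]%classic).
  by apply/seteqP; split=> t /= tA i => [_|]; exact: tA.
apply: fin_bigcap_measurable => // i _.
by rewrite -[X in measurable X]setTI; apply: measurable_tnth.
Qed.

Lemma measurable_hbox (c : R) : measurable (hbox c).
Proof.
exact: (measurableX (measurable_hbox_base c) (measurable_itv `[- c, c])).
Qed.

Lemma heis_lebesgue_hbox (c : R) : 0 < c ->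
  mu (hbox c) = ((2 * c) ^+ (n + n).+1)%:E.
Proof.
move=> c0; pose A : set mR := `[- c, c]%classic.
have leb_c : leb A = (2 * c)%:E.
  rewrite lebesgue_measure_itv/= lte_fin gtrN// -EFinB; congr EFin; ring.
transitivity (power_measure leb (n + n)
    [set t | forall i, A (tnth t i)] * leb A)%E.
  by rewrite -(product_measure1E (power_measure leb (n + n)) leb
    (measurable_hbox_base c) (measurable_itv `[- c, c])).
have mA : measurable A by exact: measurable_itv.
rewrite (power_measureE leb (A := fun=> A) (fun=> mA)).
under eq_bigr do rewrite /= leb_c.
by rewrite leb_c prodEFin -EFinM prodr_const card_ord -exprSr.
Qed.

Lemma hball_lty : (mu [set x : H | (hnorm x < 1)%R] < +oo)%E.
Proof.
have bound (b : R) : b ^+ 2 <= 1 -> b \in `[-1, 1].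
  by move=> b1; rewrite in_itv/=; apply/andP; split; nra.
apply: (@le_lt_trans _ _ (mu (hbox 1))); last first.
  by rewrite heis_lebesgue_hbox ?ltry.
apply: le_measure; rewrite ?inE.
- exact: measurable_hball.
- exact: measurable_hbox.
move=> x /=; rewrite hnorm_lt1 /hgauge => x1.
have S1 : \sum_(i < n + n) hcoord x i ^+ 2 <= 1.
  rewrite -(@ler_pXn2r _ 2)// ?nnegrE ?sumr_ge0//; last first.
    by move=> i _; exact: sqr_ge0.
  by rewrite expr1n (le_trans _ (ltW x1))// lerDl sqr_ge0.
split => [i|]; apply: bound.
  apply: le_trans S1; rewrite (bigD1 i)//= lerDl sumr_ge0// => j _.
  exact: sqr_ge0.
by apply: le_trans (ltW x1); rewrite lerDr sqr_ge0.
Qed.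

Lemma hball_gt0 : (0 < mu [set x : H | (hnorm x < 1)%R])%E.
Proof.
(* With this [c] both [k * c^2] and [c^2] are at most 1/2, so on the box [hgauge] is at most 1/4 +
   1/2 < 1. *)
pose k : R := (n + n)%:R; pose c : R := (2 * (k + 1))^-1.
have k0 : 0 <= k by [].
have k10 : 0 < k + 1 by rewrite ltr_wpDl.
have c0 : 0 < c by rewrite invr_gt0 mulr_gt0.
have ck : 2 * (k + 1) * c = 1 by rewrite mulfV// gt_eqF// mulr_gt0.
apply: (@lt_le_trans _ _ (mu (hbox c))).
  by rewrite heis_lebesgue_hbox// lte_fin exprn_gt0// mulr_gt0.
apply: le_measure; rewrite ?inE.
- exact: measurable_hbox.
- exact: measurable_hball.
have bound (b : R) : b \in `[- c, c] -> b ^+ 2 <= c ^+ 2.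
  by rewrite in_itv/= => /andP[b1 b2]; nra.
move=> x [/= xc sc]; rewrite hnorm_lt1 /hgauge.
have S1 : \sum_(i < n + n) hcoord x i ^+ 2 <= k * c ^+ 2.
  rewrite (le_trans (ler_sum _ (fun i _ => bound _ (xc i))))//.
  by rewrite sumr_const card_ord mulr_natl.
have S0 : 0 <= \sum_(i < n + n) hcoord x i ^+ 2.
  by apply: sumr_ge0 => i _; exact: sqr_ge0.
have := bound _ sc; have kc0 : 0 <= k * c by rewrite mulr_ge0// ltW.
have kc1 : k * c ^+ 2 <= 2^-1 by nra.
have : c ^+ 2 <= 2^-1 by nra.
by move: S0 S1; set S := \sum_(i < _) _; nra.
Qed.

Lemma heis_lebesgue_hball1 :
  mu [set x : H | (hnorm x < 1)%R] = (Omega_Q R n)%:E.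
Proof. by rewrite /Omega_Q fineK// ge0_fin_numE ?hball_lty. Qed.

Lemma Omega_Q_gt0 : 0 < Omega_Q R n.
Proof. by rewrite -lte_fin -heis_lebesgue_hball1 hball_gt0. Qed.

Lemma integral_hball_indicator (r : R) :
  (\int[mu]_x ((hnorm x < r)%R%:R)%:E = mu [set x : H | (hnorm x < r)%R])%E.
Proof.
rewrite -(setIT [set x : H | _]) -integral_indic//; last exact: measurable_hball.
apply: eq_integral => x _.
rewrite indicE (_ : (x \in _) = (hnorm x < r)%R)//.
by apply/idP/idP; rewrite inE.
Qed.

(** The dilation by [r] pulls the ball of radius [r] back to the unit ball, so the change of
    variables is applied to its indicator. *)
Lemma heis_lebesgue_hball (r : R) : 0 < r ->
  mu [set x : H | (hnorm x < r)%R] = (r ^+ hdim n * Omega_Q R n)%:E.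
Proof.
move=> r0.
have := @ge0_integral_hdil r (fun x => (hnorm x < r)%R%:R%:E) r0.
under eq_integral do rewrite hnorm_dil ?ltW// gtr_pMr//.
rewrite !integral_hball_indicator heis_lebesgue_hball1 EFinM => ->//; last first.
  apply/measurable_EFinP; apply: measurable_lt_indicator => //.
  exact: measurable_hnorm.
by rewrite muleA -EFinM mulfV ?mul1e// expf_neq0// gt_eqF.
Qed.

Lemma measurable_hnorm_eq0 : measurable [set x : H | hnorm x = 0].
Proof.
have -> : [set x : H | hnorm x = 0] = setT `&` (@hnorm R n) @^-1` [set 0].
  by rewrite setTI.
by apply: measurable_hnorm.
Qed.

(** The zero set of the norm lies in every ball, and small balls have small measure. *)
Lemma hnorm_eq0_null : mu [set x : H | hnorm x = 0] = 0%E.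
Proof.
apply/eqP; rewrite eq_le measure_ge0 andbT; apply/lee_addgt0Pr => e e0.
(* Since [r] is at most 1, [r ^ Q] is at most [r], and the second bound on [r] makes the ball have
   measure at most [e]. *)
rewrite add0e; pose r := Num.min 1 (e / Omega_Q R n).
have r0 : 0 < r by rewrite lt_min ltr01 divr_gt0// Omega_Q_gt0.
apply: (@le_trans _ _ (mu [set x : H | hnorm x < r])).
  apply: le_measure; rewrite ?inE//.
  - exact: measurable_hnorm_eq0.
  - exact: measurable_hball.
  by move=> x /= ->.
rewrite heis_lebesgue_hball// lee_fin -ler_pdivlMr ?Omega_Q_gt0//.
apply: (@le_trans _ _ r); last by rewrite ge_min lexx orbT.
rewrite -[leRHS]expr1; apply: ler_wiXn2l => //; first exact: ltW.
  by rewrite ge_min lexx.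
by rewrite /hdim addn2.
Qed.

End heisenberg_balls.

(** * Integrals of negative powers of the norm over balls *)

Section weighted_balls.
Context (R : realType) (n : nat).
Local Notation H := (heis R n).
Local Notation leb := (@lebesgue_measure R).
Local Notation mu := (heis_lebesgue R n).
Local Notation Q := ((hdim n)%:R : R).
Local Notation Omega := (Omega_Q R n).

Lemma hdim_gt0 : 0 < Q.
Proof. by rewrite ltr0n /hdim addn2. Qed.

Lemma measurable_hnorm_lt (r : R) :
  measurable_fun [set: H] (fun x => (hnorm x < r)%R%:R : R).
Proof. by apply: measurable_lt_indicator => //; exact: measurable_hnorm. Qed.

Lemma measurable_hnorm_gt (r : R) :
  measurable_fun [set: H] (fun x => (r < hnorm x)%R%:R : R).
Proof. by apply: measurable_lt_indicator => //; exact: measurable_hnorm. Qed.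

Lemma ae_hnorm_gt0 : {ae mu, forall x : H, 0 < hnorm x}.
Proof.
exists [set x : H | hnorm x = 0]; split; [|exact: hnorm_eq0_null|].
  exact: measurable_hnorm_eq0.
by move=> x /= /negP; rewrite -leNgt => h; apply/eqP; rewrite eq_le h hnorm_ge0.
Qed.

(** The points of norm 0 are removed because [layer_cake] requires a weight that vanishes there;
    they form a null set. *)
Lemma integral_punctured_hball (r : R) : 0 < r ->
  (\int[mu]_x ((0 < hnorm x)%R%:R * (hnorm x < r)%R%:R)%:E =
   (r ^+ hdim n * Omega)%:E)%E.
Proof.
move=> r0; rewrite -heis_lebesgue_hball// -integral_hball_indicator.
apply: ge0_ae_eq_integral => //.
- apply/measurable_EFinP; apply: measurable_funM.
    exact: measurable_hnorm_gt.
  exact: measurable_hnorm_lt.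
- by apply/measurable_EFinP; exact: measurable_hnorm_lt.
- by apply: filterS ae_hnorm_gt0 => x x0 _; rewrite x0 mul1r.
Qed.

(* Since 0 `^ (- a) = 0 for a != 0, the origin contributes nothing. *)
Definition weighted_ball (a t : R) : \bar R :=
  (\int[mu]_x (hnorm x `^ (- a) * (hnorm x < t)%R%:R)%:E)%E.

(** By the layer-cake formula the integral is that of [a s^(-a-1) Omega min(t,s)^Q] over [s > 0].
    The part up to [t] converges because [a < Q] and gives [a Omega t^(Q-a) / (Q-a)]; the tail gives
    [Omega t^(Q-a)]. *)
Lemma weighted_ballE (a t : R) : 0 < a -> a < Q -> 0 < t ->
  weighted_ball a t = (Q * Omega / (Q - a) * t `^ (Q - a))%:E.
Proof.
move=> a0 aQ t0; have Qa0 : 0 < Q - a by rewrite subr_gt0.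
have Om0 := Omega_Q_gt0 R n.
transitivity (\int[mu]_x (((0 < hnorm x)%R%:R * (hnorm x < t)%R%:R) *
    hnorm x `^ (- a))%:E)%E.
  apply: eq_integral => x _; have [h0|h0] := boolP (0 < hnorm x)%R.
    by rewrite mul1r mulrC.
  have -> : hnorm x = 0 by apply/eqP; rewrite eq_le leNgt h0 hnorm_ge0.
  by rewrite powR0 ?mulr0 ?mul0r// oppr_eq0 gt_eqF.
rewrite layer_cake//; last 4 first.
- apply: measurable_funM; first exact: measurable_hnorm_gt.
  exact: measurable_hnorm_lt.
- exact: measurable_hnorm.
- exact: hnorm_ge0.
- by move=> x ->; rewrite ltxx mul0r.
(* The parts below and above [t]. The constants are arranged so that the remaining factors are the
   integrands of [integral_powR_head] with exponent [Q - a] and of [integral_powR_tail] with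
   exponent [a]. *)
pose F1 := (fun s =>
  ((a * Omega / (Q - a)) * ((Q - a) * s `^ (Q - a - 1)))%:E : \bar R)
  \_ `]0, t]%classic.
pose F2 := (fun s => ((Omega * t ^+ hdim n) * (a * s `^ (- a - 1)))%:E : \bar R)
  \_ `]t, +oo[%classic.
transitivity (\int[leb]_s (F1 s + F2 s))%E.
  apply: eq_integral => s _; rewrite /F1 /F2 !patchE !mem_setE !in_itv/= andbT.
  (* The layer-cake integral runs over the whole line, but balls of radius [s <= 0] are empty. *)
  have [s0|s0] := leP s 0.
    rewrite (_ : (t < s) = false); last first.
      by apply/negbTE; rewrite -leNgt (le_trans s0)// ltW.
    rewrite /= adde0 integral0_eq ?mule0// => x _.
    rewrite (_ : (hnorm x < s) = false) ?mulr0//; apply/negbTE.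
    by rewrite -leNgt (le_trans s0)// hnorm_ge0.
  have inner : (\int[mu]_y ((0 < hnorm y)%R%:R * (hnorm y < t)%R%:R *
      (hnorm y < s)%R%:R)%:E =
    ((Num.min t s) ^+ hdim n * Omega)%:E)%E.
    rewrite -integral_punctured_hball ?lt_min ?t0//.
    apply: eq_integral => y _; rewrite -!natrM !mulnb.
    by rewrite lt_min andbA.
  rewrite inner//; have [ts|st] := ltP t s;
    rewrite /= ?add0e ?adde0 -EFinM; congr EFin.
    ring.
  rewrite (_ : Q - a - 1 = Q + (- a - 1)); last by ring.
  rewrite powRD; last by rewrite (gt_eqF s0) implybT.
  by rewrite powR_mulrn ?ltW//; field; exact: lt0r_neq0.
have mf (q : R) : measurable_fun [set: measurableTypeR R] (fun s => s `^ q).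
  exact: measurable_powR.
have F10 s : (0 <= F1 s)%E.
  apply: erestrict_ge0 => // x _.
  by rewrite lee_fin !mulr_ge0 ?powR_ge0 ?invr_ge0 ?ltW.
have F20 s : (0 <= F2 s)%E.
  apply: erestrict_ge0 => // x _.
  by rewrite lee_fin !mulr_ge0 ?powR_ge0 ?exprn_ge0 ?ltW.
have mF1 : measurable_fun [set: measurableTypeR R] F1.
  apply/(measurable_restrictT _ _).1 => //.
  apply/measurable_EFinP; apply: measurable_funTS.
  by do 2 apply: measurable_funM => //.
have mF2 : measurable_fun [set: measurableTypeR R] F2.
  apply/(measurable_restrictT _ _).1 => //.
  apply/measurable_EFinP; apply: measurable_funTS.
  by do 2 apply: measurable_funM => //.
rewrite ge0_integralD// -!integral_mkcond.
under eq_integral do rewrite EFinM.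
rewrite ge0_integralZl_EFin//; last 3 first.
- by move=> s _; rewrite lee_fin mulr_ge0 ?powR_ge0 ?ltW.
- by apply/measurable_EFinP; apply: measurable_funTS; exact: measurable_funM.
- by rewrite divr_ge0 ?mulr_ge0 ?ltW.
rewrite integral_powR_head//.
under [X in (_ + X)%E]eq_integral do rewrite EFinM.
rewrite ge0_integralZl_EFin//; last 3 first.
- by move=> s _; rewrite lee_fin mulr_ge0 ?powR_ge0 ?ltW.
- by apply/measurable_EFinP; apply: measurable_funTS; exact: measurable_funM.
- by rewrite mulr_ge0 ?exprn_ge0 ?ltW.
rewrite integral_powR_tail//.
rewrite -!EFinM -EFinD; congr EFin.
have -> : t `^ (- a) = t `^ (Q - a) / t ^+ hdim n.
  rewrite -powR_mulrn ?ltW// -powRB ?(gt_eqF t0) ?implybT//.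
  by congr (_ `^ _); ring.
have tQ : t ^+ hdim n != 0 by rewrite expf_neq0// gt_eqF.
by field; rewrite tQ lt0r_neq0.
Qed.

End weighted_balls.

Lemma measurable_bigmax d (T : measurableType d) (R : realType) (I : Type)
    (s : seq I) (f : T -> R) (F : I -> T -> R) :
  measurable_fun [set: T] f -> (forall i, measurable_fun [set: T] (F i)) ->
  measurable_fun [set: T] (fun x => \big[Num.max/f x]_(i <- s) F i x).
Proof.
move=> mf mF; elim: s => [|i s IHs].
  by under eq_fun do rewrite big_nil.
by under eq_fun do rewrite big_cons; exact: measurable_maxr.
Qed.

(** * The integral of the power weights against the kernel *)

Section hlp_integral.
Context (R : realType) (n : nat).
Local Notation H := (heis R n).
Local Notation leb := (@lebesgue_measure R).
Local Notation mu := (heis_lebesgue R n).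
Local Notation Q := ((hdim n)%:R : R).
Local Notation Omega := (Omega_Q R n).

Lemma measurable_weight (a : R) :
  measurable_fun [set: H] (fun x : H => hnorm x `^ (- a)).
Proof. exact: (measurableT_comp (measurable_powR _) (@measurable_hnorm R n)). Qed.

Lemma measurable_truncated_weight (a t : R) :
  measurable_fun [set: H] (fun x : H => hnorm x `^ (- a) * (hnorm x < t)%R%:R).
Proof.
by apply: measurable_funM; [exact: measurable_weight|exact: measurable_hnorm_lt].
Qed.

(* Compare with the exponents Q - e as e -> 0, for which the integral over the
   unit ball is Q * Omega / e. *)
Lemma weighted_ball_pinfty (a t : R) : Q <= a -> 1 <= t ->
  weighted_ball n a t = +oo%E.
Proof.
move=> Qa t1; apply/eqyP => A A0.
have Q0 := hdim_gt0 R n; have Om0 := Omega_Q_gt0 R n.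
(* The first bound keeps the exponent [Q - e] positive; the second makes the integral
   [Q * Omega / e] at least [A]. *)
pose e := Num.min (Q / 2) (Q * Omega / A).
have e0 : 0 < e by rewrite lt_min !divr_gt0 ?mulr_gt0.
have eQ : e < Q by rewrite gt_min ltr_pdivrMr// ltr_pMr// ltr1n.
have Qe0 : 0 < Q - e by rewrite subr_gt0.
apply: (@le_trans _ _ (weighted_ball n (Q - e) 1)).
  rewrite weighted_ballE//; last by rewrite gtrBl.
  rewrite lee_fin powR1 mulr1 opprB addrC subrK ler_pdivlMr//.
  by rewrite mulrC -ler_pdivlMr// ge_min lexx orbT.
apply: ge0_le_integral => //.
- by move=> x _; rewrite lee_fin mulr_ge0 ?powR_ge0.
- by apply/measurable_EFinP; exact: measurable_truncated_weight.
- by apply/measurable_EFinP; exact: measurable_truncated_weight.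
move=> x _; rewrite lee_fin; have [x1|x1] := ltP (hnorm x) 1; last first.
  by rewrite mulr0 mulr_ge0 ?powR_ge0.
rewrite (lt_le_trans x1 t1) !mulr1.
(* At norm 0 both powers are 0 by convention; elsewhere in the unit ball the power with the more
   negative exponent is the larger. *)
have [->|hx0] := eqVneq (hnorm x) 0.
  by rewrite !powR0 ?oppr_eq0 ?gt_eqF// (lt_le_trans Q0).
have hx : 0 < hnorm x by rewrite lt_neqAle eq_sym hx0 hnorm_ge0.
apply: ger_powR; first by rewrite hx ltW.
by rewrite lerN2 (le_trans _ Qa)// gerBl ltW.
Qed.

(** Ensures that an infinite factor of a product of such integrals is not cancelled by a zero
    one. *)
Lemma weighted_ball_gt0 (a t : R) : 0 < a -> 1 <= t ->
  (0 < weighted_ball n a t)%E.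
Proof.
move=> a0 t1; have [Qa|aQ] := leP Q a; first by rewrite weighted_ball_pinfty.
have t0 : 0 < t := lt_le_trans ltr01 t1.
rewrite weighted_ballE// lte_fin mulr_gt0 ?powR_gt0// divr_gt0 ?subr_gt0//.
by rewrite mulr_gt0 ?hdim_gt0 ?Omega_Q_gt0.
Qed.

Variables (m : nat) (a : 'I_m -> R).
Hypotheses (m_gt0 : (0 < m)%N) (a_gt0 : forall i, 0 < a i).

(** The maximum without the power [Q]: the kernel becomes a single negative power of this function,
    as [layer_cake] needs. *)
Definition hmax (r : R) (y : m.-tuple H) : R :=
  \big[Num.max/r]_(i < m) hnorm (tnth y i).

(** Raising to the power [Q] is monotone on nonnegative reals, so it commutes with the maximum; the
    relation [K] carries this and nonnegativity through the iterated maximum. *)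
Lemma hmax_kernel (r : R) (y : m.-tuple H) : 0 < r ->
  (\big[Num.max/r ^+ hdim n]_(i < m) hnorm (tnth y i) ^+ hdim n) ^- m =
  hmax r y `^ (- (hdim n * m)%:R).
Proof.
move=> r0; have M0 : 0 <= hmax r y by rewrite (le_trans (ltW r0))// bigmax_ge_id.
rewrite powR_invn// exprM; congr (_ ^- _).
pose K (u v : R) := 0 <= v /\ u = v ^+ hdim n.
suff [] : K (\big[Num.max/r ^+ hdim n]_(i < m) hnorm (tnth y i) ^+ hdim n)
            (hmax r y) by [].
rewrite /hmax; apply: (big_ind2 K) => [|u1 u2 v1 v2 [u20 ->] [v20 ->]|i _].
- by split => //; exact: ltW.
- split; first by rewrite le_max u20.
  have [uv|vu] := leP u2 v2.
    by apply/max_idPr; rewrite lerXn2r// nnegrE.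
  by apply/max_idPl; rewrite lerXn2r ?ltW// nnegrE.
- by split => //; exact: hnorm_ge0.
Qed.

Lemma hmax_gt0 (r : R) (y : m.-tuple H) : 0 < r -> 0 < hmax r y.
Proof. by move=> /lt_le_trans; apply; exact: bigmax_ge_id. Qed.

Lemma measurable_hmax (r : R) : measurable_fun [set: m.-tuple H] (hmax r).
Proof.
apply: measurable_bigmax => // i.
exact: (measurableT_comp (@measurable_hnorm R n) (measurable_tnth i)).
Qed.

(** The sublevel sets are products of balls, so the integral over them factorizes. *)
Lemma hmax_lt (r s : R) (y : m.-tuple H) :
  (hmax r y < s) = (r < s) && [forall i, hnorm (tnth y i) < s].
Proof.
apply/bigmax_ltP/andP => -[rs ys]; split=> //.
  by apply/forallP => i; exact: ys.
by move=> i _; move/forallP: ys.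
Qed.

Lemma prod_indicator (I : finType) (P : pred I) :
  \prod_i (P i)%:R = [forall i, P i]%:R :> R.
Proof.
have [/forallP PT|] := boolP [forall i, P i].
  by rewrite big1// => i _; rewrite PT.
by rewrite negb_forall => /existsP[i /negbTE Pi]; rewrite (bigD1 i)//= Pi mul0r.
Qed.


Lemma hlp_integralE (r : R) : 0 < r ->
  (\int[power_measure mu m]_y ((\prod_(i < m) hnorm (tnth y i) `^ (- a i)) *
     (\big[Num.max/r ^+ hdim n]_(i < m) hnorm (tnth y i) ^+ hdim n) ^- m)%:E =
   \int[leb]_(s in `]r, +oo[)
     (((hdim n * m)%:R * s `^ (- (hdim n * m)%:R - 1))%:E *
      \prod_(i < m) weighted_ball n (a i) s))%E.
Proof.
move=> r0; under eq_integral do rewrite hmax_kernel//.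
rewrite layer_cake//; last 6 first.
- by rewrite ltr0n muln_gt0 m_gt0 /hdim addn2.
- exact: (measurable_prod_tnth (fun i => measurable_weight (a i))).
- exact: measurable_hmax.
- by move=> y; apply: prodr_ge0 => i _; exact: powR_ge0.
- by move=> y; rewrite ltW// hmax_gt0.
(* [hmax r y] is at least [r > 0], so the condition on its zeros is vacuous. *)
- by move=> y y0; have := hmax_gt0 y r0; rewrite y0 ltxx.
rewrite [RHS]integral_mkcond; apply: eq_integral => s _.
(* For [s <= r] the sublevel set is empty, which is why the integral starts at [r]. *)
rewrite patchE mem_setE in_itv/= andbT; case: ifPn => rs; last first.
  rewrite integral0_eq ?mule0// => y _.
  by rewrite hmax_lt (negbTE rs) mulr0.
rewrite -integral_power_measure_prod; last 2 first.
- by move=> i; exact: measurable_truncated_weight.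
- by move=> i x; rewrite mulr_ge0 ?powR_ge0.
congr (_ * _)%E; apply: eq_integral => y _; rewrite big_split/=.
congr (_ * _)%:E.
by rewrite hmax_lt rs prod_indicator.
Qed.

Lemma sum_weights_gt0 : 0 < \sum_(i < m) a i.
Proof.
rewrite (bigD1 (Ordinal m_gt0))//= ltr_wpDr// sumr_ge0// => i _.
exact: ltW.
Qed.

Lemma prod_powR (I : Type) (l : seq I) (s : R) (F : I -> R) : 0 < s ->
  \prod_(i <- l) s `^ F i = s `^ (\sum_(i <- l) F i).
Proof.
move=> s0; elim/big_rec2: _ => [|i u v _ ->]; first by rewrite powRr0.
by rewrite powRD// (gt_eqF s0) implybT.
Qed.

(** The weighted balls contribute [s^(Qm - alpha)], which turns [s^(-Qm-1)] into [s^(-alpha-1)]. Its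
    integral from [r] on is [r^(-alpha) / alpha], the source of [alpha] in the denominator. *)
Lemma hlp_integral_fin (r : R) : (forall i, a i < Q) -> 0 < r ->
  (\int[power_measure mu m]_y ((\prod_(i < m) hnorm (tnth y i) `^ (- a i)) *
     (\big[Num.max/r ^+ hdim n]_(i < m) hnorm (tnth y i) ^+ hdim n) ^- m)%:E =
  (m%:R * Q * omega_Q R n ^+ m /
    ((\sum_(i < m) a i) * \prod_(i < m) (Q - a i))
    * r `^ (- \sum_(i < m) a i))%:E)%E.
Proof.
move=> aQ r0; rewrite hlp_integralE//.
set al := \sum_(i < m) a i; have al0 : 0 < al by exact: sum_weights_gt0.
have Qa0 i : 0 < Q - a i by rewrite subr_gt0.
have Om0 := Omega_Q_gt0 R n; have Q0 := hdim_gt0 R n.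
pose K := (hdim n * m)%:R * (Q * Omega) ^+ m / \prod_(i < m) (Q - a i) / al.
have K0 : 0 <= K.
  rewrite !divr_ge0 ?mulr_ge0 ?exprn_ge0 ?prodr_ge0 ?mulr_ge0// => *;
    by rewrite ltW.
transitivity (\int[leb]_(s in `]r, +oo[) (K%:E * (al * s `^ (- al - 1))%:E))%E.
  apply: eq_integral => s; rewrite inE/= in_itv/= andbT => rs.
  have s0 : 0 < s := lt_trans r0 rs.
  under eq_bigr do rewrite weighted_ballE//.
  rewrite prodEFin -!EFinM; congr EFin.
  rewrite big_split/= prod_powR// sumrB -/al.
  rewrite big_split/= prodr_const prodfV cardE size_enum_ord.
  rewrite sumr_const cardE size_enum_ord -mulrnA.
  rewrite (_ : - al - 1 = (- (hdim n * m)%:R - 1) + ((hdim n * m)%:R - al));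
    last by ring.
  rewrite [in RHS]powRD; last by rewrite (gt_eqF s0) implybT.
  have P0 : \prod_(i < m) (Q - a i) != 0.
    by rewrite gt_eqF//; apply: prodr_gt0.
  by rewrite /K; field; rewrite P0 lt0r_neq0.
rewrite ge0_integralZl_EFin//; last 2 first.
- by move=> s _; rewrite lee_fin mulr_ge0 ?powR_ge0 ?ltW.
- apply/measurable_EFinP; apply: measurable_funTS.
  by apply: measurable_funM => //; exact: measurable_powR.
rewrite integral_powR_tail// -EFinM; congr EFin.
rewrite /K /omega_Q natrM; congr (_ * _).
have P0 : \prod_(i < m) (Q - a i) != 0.
  by rewrite gt_eqF//; apply: prodr_gt0.
by field; rewrite P0 lt0r_neq0.
Qed.

(** For every [s > 1] the factor of index [i] is infinite and the others are positive, so the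
    integrand is [+oo] on a half-line. *)
Lemma hlp_integral_pinfty i : Q <= a i ->
  hlp_const R n a = +oo%E.
Proof.
move=> Qa; have := hlp_integralE ltr01; rewrite expr1n /hlp_const => ->.
transitivity (\int[leb]_(s in `]1%R, +oo[) cst +oo s)%E; last first.
  by rewrite integral_cst//= lebesgue_measure_itv/= ltry mulyy.
apply: eq_integral => s; rewrite inE/= in_itv/= andbT => s1.
have p0 : (0 < (hdim n * m)%:R * s `^ (- (hdim n * m)%:R - 1)).
  rewrite mulr_gt0 ?ltr0n ?muln_gt0 ?m_gt0 ?powR_gt0 ?(lt_trans ltr01)//.
  by rewrite /hdim addn2.
rewrite (bigD1 i)//= weighted_ball_pinfty ?(ltW s1)//.
rewrite gt0_mulye.
  by rewrite gt0_muley.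
apply: (big_ind (fun x => 0 < x)%E) => // [|j _]; first exact: mule_gt0.
by apply: weighted_ball_gt0 => //; exact: ltW.
Qed.

End hlp_integral.

(** * The Hardy-Littlewood-Polya operator *)

Section hlp_operator.
Context (R : realType) (n m : nat) (a : 'I_m -> R).
Local Notation H := (heis R n).
Local Notation mu := (heis_lebesgue R n).
Local Notation pm := (power_measure mu m).
Local Notation Q := ((hdim n)%:R : R).
Local Notation alpha := (\sum_(i < m) a i).
Local Notation K := (hlp_kernel R n m).
Local Notation C := (m%:R * Q * omega_Q R n ^+ m /
  (alpha * \prod_(j < m) (Q - a j))).
Hypotheses (m_gt0 : (0 < m)%N) (a_gt0 : forall i, 0 < a i).
Hypothesis aQ : forall i, a i < Q.

(** Over a space of measure zero an essential supremum would be [-oo]; positive mass makes the norms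
    nonnegative and gives a.e. constant functions the expected norm. *)
Lemma heis_lebesgue_setT_gt0 : (0 < mu [set: H])%E.
Proof.
apply: lt_le_trans (hball_gt0 R n) _; apply: le_measure; rewrite ?inE//.
exact: measurable_hball.
Qed.

Lemma powR_weight_cancel (b : R) (x : H) : 0 < hnorm x ->
  hnorm x `^ b * hnorm x `^ (- b) = 1.
Proof. by move=> x0; rewrite powRN mulfV// gt_eqF// powR_gt0. Qed.

Lemma hlp_const_ge0 : 0 <= C.
Proof.
apply: divr_ge0.
  by rewrite !mulr_ge0// exprn_ge0// mulr_ge0// ltW// Omega_Q_gt0.
rewrite mulr_ge0 ?ltW ?sum_weights_gt0//.
by apply: prodr_gt0 => i _; rewrite subr_gt0.
Qed.

Lemma hlp_kernel_ge0 (x : H) (y : m.-tuple H) : 0 <= K x y.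
Proof.
rewrite invr_ge0 exprn_ge0// (le_trans _ (bigmax_ge_id _ _ _ _))//.
by rewrite exprn_ge0// hnorm_ge0.
Qed.

Lemma integral_weights_hlp_kernel (x : H) : 0 < hnorm x ->
  (\int[pm]_y ((\prod_(i < m) hnorm (tnth y i) `^ (- a i)) * K x y)%:E =
   (C * hnorm x `^ (- alpha))%:E)%E.
Proof. by move=> x0; exact: hlp_integral_fin. Qed.

(** Joint measurability is what Tonelli requires for the operator's output to be measurable in
    [x]. *)
Lemma measurable_hlp_kernel :
  measurable_fun [set: H * m.-tuple H] (fun z => K z.1 z.2).
Proof.
have mh : measurable_fun [set: H] (fun x : H => hnorm x ^+ hdim n).
  by apply: measurable_funX; exact: measurable_hnorm.
rewrite /hlp_kernel.
under eq_fun => z.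
  rewrite -powR_inv1; last first.
    rewrite exprn_ge0// (le_trans _ (bigmax_ge_id _ _ _ _))//.
    by rewrite exprn_ge0// hnorm_ge0.
  over.
apply: (measurableT_comp (measurable_powR _)).
apply: measurable_funX; apply: measurable_bigmax.
  exact: (measurableT_comp mh measurable_fst).
move=> i; apply: (measurableT_comp mh).
exact: (measurableT_comp (measurable_tnth i) measurable_snd).
Qed.

Lemma measurable_mlin_integrand (f : 'I_m -> H -> R) :
  (forall i, measurable_fun [set: H] (f i)) ->
  measurable_fun [set: H * m.-tuple H] (fun z => mlin_integrand K f z.1 z.2).
Proof.
move=> mf; apply: measurable_funM; last exact: measurable_hlp_kernel.
exact: (measurableT_comp (measurable_prod_tnth mf) measurable_snd).
Qed.

(** No integrability is assumed: the integral is by definition a difference of the integrals of the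
    positive and negative parts, each measurable in [x] by Tonelli, and [fine] is measurable. *)
Lemma measurable_mlin_op (f : 'I_m -> H -> R) :
  (forall i, measurable_fun [set: H] (f i)) ->
  measurable_fun [set: H] (mlin_op K f).
Proof.
move=> mf; pose g (z : H * m.-tuple H) := (mlin_integrand K f z.1 z.2)%:E.
have mg : measurable_fun [set: H * m.-tuple H] g.
  by apply/measurable_EFinP; exact: measurable_mlin_integrand.
apply: (measurableT_comp (fine_measurable measurableT)).
rewrite (_ : (fun x => _) = fubini_F pm g^\+%E \- fubini_F pm g^\-%E)%E; last first.
  apply/funext => x; rewrite [LHS]integralE /fubini_F.
  rewrite -[LHS]/(\int[pm]_y (g \o pair x)^\+ y - \int[pm]_y (g \o pair x)^\- y)%E.
  by rewrite funepos_comp funeneg_comp.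
by apply: emeasurable_funB; apply: measurable_fun_fubini_tonelli_F => //;
  [exact: measurable_funepos|exact: measurable_funeneg].
Qed.

Lemma Hinf_norm_ge0 (b : R) (f : H -> R) : (0 <= Hinf_norm b f)%E.
Proof.
apply: ess_sup_gee; first exact: heis_lebesgue_setT_gt0.
by apply: aeW => x; rewrite lee_fin mulr_ge0 ?powR_ge0.
Qed.

Lemma Hinf_fin_num (b : R) (f : H -> R) :
  Hinf b f -> Hinf_norm b f \is a fin_num.
Proof. by move=> [_ ?]; rewrite ge0_fin_numE// Hinf_norm_ge0. Qed.

(** * Boundedness of the operator with the stated constant *)

Section upper_bound.
Variable f : 'I_m -> H -> R.
Hypothesis Hf : forall i, Hinf (a i) (f i).
Let M i : R := fine (Hinf_norm (a i) (f i)).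

Let Hinf_normE i : Hinf_norm (a i) (f i) = (M i)%:E.
Proof. by rewrite fineK// Hinf_fin_num. Qed.

Let f_le i : {ae mu, forall x : H, `|f i x| <= M i * hnorm x `^ (- a i)}.
Proof.
have aeM :
    {ae mu, forall x : H, ((hnorm x `^ a i * `|f i x|)%:E <= (M i)%:E)%E}.
  by rewrite -Hinf_normE; exact: ess_sup_ge.
apply: filterS2 (ae_hnorm_gt0 R n) aeM => x x0; rewrite lee_fin => fM.
by rewrite powRN ler_pdivlMr ?(powR_gt0 _ x0)// [leLHS]mulrC.
Qed.

(** Each [f i] is dominated a.e. by [M i] times its power weight, and the integral of the product of
    the weights against the kernel is known. The exceptional null set lies in the [y] variables, so
    the bound holds for every [x] of nonzero norm. *)
Lemma integral_abs_mlin_integrand_le (x : H) : 0 < hnorm x ->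
  (\int[pm]_y `|(mlin_integrand K f x y)%:E| <=
    ((\prod_(i < m) M i) * (C * hnorm x `^ (- alpha)))%:E)%E.
Proof.
move=> x0; have M0 i : 0 <= M i by rewrite -lee_fin -Hinf_normE Hinf_norm_ge0.
have wK0 y : 0 <= (\prod_(i < m) hnorm (tnth y i) `^ (- a i)) * K x y.
  rewrite mulr_ge0 ?hlp_kernel_ge0// prodr_ge0// => i _; exact: powR_ge0.
have mK : measurable_fun [set: m.-tuple H] (K x).
  exact: (measurableT_comp measurable_hlp_kernel (measurable_pair1 x)).
have mwK : measurable_fun [set: m.-tuple H]
    (fun y => (\prod_(i < m) hnorm (tnth y i) `^ (- a i)) * K x y).
  apply: measurable_funM; last exact: mK.
  apply: (@measurable_prod_tnth _ H R m (fun i x => hnorm x `^ (- a i))) => i.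
  exact: measurable_weight.
rewrite EFinM -integral_weights_hlp_kernel// -ge0_integralZl_EFin//; last 3 first.
- by move=> y _; rewrite lee_fin.
- exact/measurable_EFinP.
- exact: prodr_ge0.
apply: ae_ge0_le_integral => //.
- apply: measurableT_comp => //; apply/measurable_EFinP.
  exact: (measurableT_comp (measurable_mlin_integrand (fun i => (Hf i).1))
    (measurable_pair1 x)).
- by move=> y _; rewrite -EFinM lee_fin mulr_ge0// prodr_ge0.
- by apply/measurable_EFinP; exact: measurable_funM.
apply: filterS (ae_forall_tnth f_le) => y fy _.
rewrite abse_EFin -EFinM lee_fin /mlin_integrand normrM mulrA.
rewrite (ger0_norm (hlp_kernel_ge0 _ _)) ler_wpM2r ?hlp_kernel_ge0//.
by rewrite normr_prod -big_split/=; apply: ler_prod => i _; rewrite normr_ge0 fy.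
Qed.

Lemma integrable_mlin_integrand (x : H) : 0 < hnorm x ->
  pm.-integrable [set: m.-tuple H] (fun y => (mlin_integrand K f x y)%:E).
Proof.
move=> x0; apply/integrableP; split.
  apply/measurable_EFinP.
  exact: (measurableT_comp (measurable_mlin_integrand (fun i => (Hf i).1))
    (measurable_pair1 x)).
by apply: le_lt_trans (integral_abs_mlin_integrand_le x0) _; rewrite ltry.
Qed.

Lemma Hinf_norm_mlin_op_le :
  (Hinf_norm alpha (mlin_op K f) <=
    C%:E * \prod_(i < m) Hinf_norm (a i) (f i))%E.
Proof.
have -> : (\prod_(i < m) Hinf_norm (a i) (f i) = (\prod_(i < m) M i)%:E)%E.
  by rewrite -prodEFin; apply: eq_bigr => i _; exact: Hinf_normE.
rewrite -EFinM; apply/ess_supP.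
apply: filterS (ae_hnorm_gt0 R n) => x x0; rewrite lee_fin.
have mfx :
    measurable_fun [set: m.-tuple H] (fun y => (mlin_integrand K f x y)%:E).
  by have /integrableP[] := integrable_mlin_integrand x0.
have := le_trans (le_abse_integral pm measurableT mfx)
  (integral_abs_mlin_integrand_le x0).
rewrite -(fineK (integrable_fin_num measurableT (integrable_mlin_integrand x0))).
rewrite abse_EFin lee_fin => op_le.
rewrite -(ler_pdivlMl _ _ (powR_gt0 alpha x0)) -powRN.
by apply: le_trans op_le _; rewrite le_eqVlt; apply/orP; left; apply/eqP; ring.
Qed.

End upper_bound.

Lemma hlp_op_bound : op_bound K a alpha C.
Proof.
move=> f Hf; have opC := Hinf_norm_mlin_op_le Hf; split; last exact: opC.
- apply: filterS (ae_hnorm_gt0 R n) => x; exact: integrable_mlin_integrand.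
- split; first by apply: measurable_mlin_op => i; exact: (Hf i).1.
  apply: le_lt_trans opC _.
  have : (C%:E * \prod_(i < m) Hinf_norm (a i) (f i))%E \is a fin_num.
    rewrite fin_numM//; apply: prode_fin_num => i _; exact: Hinf_fin_num.
  by rewrite fin_numElt => /andP[].
Qed.

(** The weighted function is a.e. the constant [c]. This gives the norms of both the extremal inputs
    and their image. *)
Lemma Hinf_norm_cancel (b c : R) (f : H -> R) : 0 <= c ->
  (forall x, 0 < hnorm x -> f x = c * hnorm x `^ (- b)) ->
  Hinf_norm b f = c%:E.
Proof.
move=> c0 fE; apply: (ess_sup_ae_cst c%:E); first exact: heis_lebesgue_setT_gt0.
apply: filterS (ae_hnorm_gt0 R n) => x x0.
rewrite fE// ger0_norm ?mulr_ge0 ?powR_ge0//.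
by rewrite mulrCA powR_weight_cancel// mulr1.
Qed.

Lemma hlp_op_bound_le (C' : R) : op_bound K a alpha C' -> C <= C'.
Proof.
pose f i (x : H) : R := hnorm x `^ (- a i).
have normf i : Hinf_norm (a i) (f i) = 1%:E.
  by apply: Hinf_norm_cancel => // x _; rewrite mul1r.
have Hf i : Hinf (a i) (f i).
  by split; [exact: measurable_weight|rewrite normf ltry].
move=> /(_ f Hf)[_ _].
(* The image of the power weights is [C |x|_h^(-alpha)], of norm [C], while each input has norm
   1. *)
rewrite (@Hinf_norm_cancel _ C) ?hlp_const_ge0//; last first.
  move=> x x0; rewrite /mlin_op /Rintegral.
  by rewrite (integral_weights_hlp_kernel x0).
rewrite [X in (_ * X)%E]big1; last by move=> i _; exact: normf.
by rewrite mule1 lee_fin.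
Qed.

End hlp_operator.

Theorem theorem4 (R : realType) (n m : nat) (a : 'I_m -> R)
    (n_gt0 : (0 < n)%N) (m_gt0 : (0 < m)%N) (a_gt0 : forall i, 0 < a i) :
  let alpha := \sum_(i < m) a i in
  let Q := (hdim n)%:R : R in
  (hlp_const R n a < +oo)%E ->
  op_bounded (hlp_kernel R n m) a alpha /\
  is_op_norm (hlp_kernel R n m) a alpha
    (m%:R * Q * omega_Q R n ^+ m / (alpha * \prod_(j < m) (Q - a j))).
Proof.
move=> alpha Q fin_const.
(* This makes every factor [Q - a j] of the closed form positive. *)
have aQ i : a i < Q.
  rewrite ltNge; apply/negP => /(hlp_integral_pinfty m_gt0 a_gt0) constE.
  by rewrite constE ltxx in fin_const.
have bound := hlp_op_bound m_gt0 a_gt0 aQ.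
split; first by eexists; exact: bound.
by split=> // C'; exact: hlp_op_bound_le.
Qed.
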